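(* Let $\mathcal A$ be a unital Banach algebra, $1\in\mathcal B\subset\mathcal A$ a unital commutative Banach subalgebra, and $E:\mathcal A\to\mathcal B$ a conditional expectation. Let $a_1,a_2\in\mathcal A$ be non-zero elements that are $\mathcal B$-free with respect to $E$ and such that $E(a_1)$ and $E(a_2)$ are invertible in $\mathcal B$. Let $b\in\mathcal B$ be an invertible element of $\mathcal B$ with $$\|b\|<\min\left(\frac{1}{11\|a_1\|^2\|E(a_1)^{-1}\|^2},\ \frac{1}{11\|a_2\|^2\|E(a_2)^{-1}\|^2},\ \frac{1}{11\|a_1a_2\|^2\|E(a_1a_2)^{-1}\|^2}\right).$$ Then $$S_{a_1a_2}(b)=S_{a_1}(b)\,S_{a_2}(b).$$
   Context: Banach algebras are over $\mathbb C$, with $\|1\|=1$. A conditional expectation $E:\mathcal A\to\mathcal B$ is a linear map with $E(b)=b$ for all $b\in\mathcal B$, which is norm-decreasing ($\|E(a)\|\le\|a\|$), and satisfies $E(b_1ab_2)=b_1E(a)b_2$ for $b_1,b_2\in\mathcal B$, $a\in\mathcal A$. $\mathcal B$-freeness: $a_1,a_2\in\mathcal A$ are $\mathcal B$-free with respect to $E$ if for all $n\in\mathbb N$, all indices $i_1,\dots,i_n\in\{1,2\}$ with $i_1\ne i_2\ne\cdots\ne i_n$ (consecutive indices differ), and all $x_j\in\mathrm{alg}(\mathcal B,a_{i_j})$ (the subalgebra of $\mathcal A$ generated by $\mathcal B$ and $a_{i_j}$) with $E(x_j)=0$ for $j=1,\dots,n$, one has $E(x_1x_2\cdots x_n)=0$.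 (In particular $E(a_1a_2)=E(a_1)E(a_2)$, which is invertible in $\mathcal B$ under the hypotheses of the claim.) Notation: $\mathcal B(0,\epsilon)=\{b\in\mathcal B:\|b\|<\epsilon\}$, and $\mathcal B(0,\epsilon)_{\mathrm{inv}}$ is the set of elements of $\mathcal B(0,\epsilon)$ that are invertible in $\mathcal B$. For non-zero $a\in\mathcal A$ with $E(a)$ invertible in $\mathcal B$, define $\Psi_a:\mathcal B(0,\tfrac1{\|a\|})\to\mathcal B$ by $\Psi_a(b)=\sum_{n=1}^\infty E((ba)^n)=E((1-ba)^{-1})-1$. The map $\Psi_a$ is injective on $\mathcal B(0,\tfrac1{4\|a\|^2\|E(a)^{-1}\|})$, and the image of this ball contains $\mathcal B(0,\tfrac1{11\|a\|^2\|E(a)^{-1}\|^2})$; $\Psi_a^{\langle-1\rangle}$ denotes the compositional inverse of the restriction of $\Psi_a$ to $\mathcal B(0,\tfrac1{4\|a\|^2\|E(a)^{-1}\|})$. The amalgamated $S$-transform of $a$ is $$S_a(b)=b^{-1}(1+b)\,\Psi_a^{\langle-1\rangle}(b),\qquad b\in\mathcal B\left(0,\tfrac1{11\|a\|^2\|E(a)^{-1}\|^2}\right)_{\mathrm{inv}}.$$ *)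

(* Defs.v *)
From HB Require Import structures.
From mathcomp Require Import all_boot all_order all_algebra complex.
From mathcomp Require Import all_classical all_reals all_analysis.

Set Implicit Arguments.
Unset Strict Implicit.
Unset Printing Implicit Defensive.

Import Order.TTheory GRing.Theory Num.Theory.
Import numFieldNormedType.Exports.

Local Open Scope classical_set_scope.
Local Open Scope ring_scope.

(* Hierarchy-Builder cannot join algType with completeNormedModType: it would
   also need a common ancestor of rings and normed modules below numDomainType.
   The algebra structure is therefore put on the carrier of a record. *)
Record banachAlg (K : numFieldType) := BanachAlg {
  ba_space : completeNormedModType K ;
  ba_one : ba_space ;
  ba_mul : ba_space -> ba_space -> ba_space ;
  ba_mulA : associative ba_mul ;
  ba_mul1x : left_id ba_one ba_mul ;
  ba_mulx1 : right_id ba_one ba_mul ;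
  ba_mulDl : left_distributive ba_mul +%R ;
  ba_mulDr : right_distributive ba_mul +%R ;
  ba_scaleAl : forall (k : K) x y, k *: ba_mul x y = ba_mul (k *: x) y ;
  ba_scaleAr : forall (k : K) x y, k *: ba_mul x y = ba_mul x (k *: y) ;
  ba_norm1 : `|ba_one| = 1 ;
  ba_normM : forall x y, `|ba_mul x y| <= `|x| * `|y| ;
}.

Definition ba_sort (K : numFieldType) (A : banachAlg K) : Type := ba_space A.
Coercion ba_sort : banachAlg >-> Sortclass.

Section BanachAlgebraInstances.
Variables (K : numFieldType) (A : banachAlg K).

HB.instance Definition _ := CompleteNormedModule.copy (ba_sort A) (ba_space A).

Fact ba_one_neq0 : (ba_one A : ba_sort A) != 0.
Proof.
by apply/eqP => e; have := ba_norm1 A; rewrite e normr0 => /esym/eqP; rewrite oner_eq0.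
Qed.

HB.instance Definition _ := GRing.Zmodule_isNzRing.Build (ba_sort A)
  (@ba_mulA K A) (@ba_mul1x K A) (@ba_mulx1 K A)
  (@ba_mulDl K A) (@ba_mulDr K A) ba_one_neq0.

HB.instance Definition _ :=
  GRing.Lmodule_isLalgebra.Build K (ba_sort A) (@ba_scaleAl K A).

HB.instance Definition _ :=
  GRing.Lalgebra_isAlgebra.Build K (ba_sort A) (@ba_scaleAr K A).

End BanachAlgebraInstances.

Section AmalgamatedStransform.
Variables (K : numFieldType) (A : banachAlg K).
Implicit Types (B : set A) (E : A -> A) (a b : A).

Definition subalgebra B : Prop := GRing.subalg_closed [in B].

Record comm_banach_subalgebra B : Prop := CommBanachSubalgebra {
  cbs_subalgebra : subalgebra B ;
  cbs_closed : closed B ;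
  cbs_comm : forall b1 b2, B b1 -> B b2 -> b1 * b2 = b2 * b1 ;
}.

Record cond_expectation B (E : {linear A -> A}) : Prop := CondExpectation {
  cexp_mem : forall a, B (E a) ;
  cexp_id : forall b, B b -> E b = b ;
  cexp_norm : forall a, `|E a| <= `|a| ;
  cexp_bimod : forall b1 b2 a, B b1 -> B b2 -> E (b1 * a * b2) = b1 * E a * b2 ;
}.

Definition gen_alg B a : set A := smallest subalgebra (B `|` [set a]).

(* The indices 1 and 2 are encoded as false and true.  Words are nonempty:
   the empty product is 1 and E 1 = 1. *)
Definition free_over B E a1 a2 : Prop :=
  forall (n : nat) (i : nat -> bool) (x : nat -> A),
    (0 < n)%N ->
    (forall j, (j.+1 < n)%N -> i j != i j.+1) ->
    (forall j, (j < n)%N -> gen_alg B (if i j then a2 else a1) (x j)) ->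
    (forall j, (j < n)%N -> E (x j) = 0) ->
    E (\prod_(0 <= j < n) x j) = 0.

Definition is_inverse_in B b c : Prop := [/\ B c, b * c = 1 & c * b = 1].

Definition invertible_in B b : Prop := B b /\ exists c, is_inverse_in B b c.

(* The inverse of b in B, and 0 when there is none. *)
Definition inv_in B b : A := xget 0 [set c | is_inverse_in B b c].

Definition ball0 B (r : K) : set A := [set b | B b /\ `|b| < r].

Definition Psi E a b : A := \big[+%R/0]_(1 <= n <oo) E ((b * a) ^+ n).

Definition inj_radius B E a : K :=
  (4 * `|a| ^+ 2 * `|inv_in B (E a)|)^-1.

(* S_transform below is meant for b invertible in B with `|b| < S_radius. *)
Definition S_radius B E a : K :=
  (11 * `|a| ^+ 2 * `|inv_in B (E a)| ^+ 2)^-1.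

(* Compositional inverse of the restriction of Psi E a to the ball of radius
   inj_radius B E a, with value 0 off the image of that ball. *)
Definition Psi_inv B E a : A -> A :=
  'pinv_(fun=> 0) (ball0 B (inj_radius B E a)) (Psi E a).

Definition S_transform B E a b : A :=
  inv_in B b * (1 + b) * Psi_inv B E a b.

End AmalgamatedStransform.

(* Main.v *)
Require Import Defs.
From mathcomp Require Import all_boot all_order all_algebra complex.
From mathcomp Require Import all_classical all_reals all_analysis.
From mathcomp Require Import ring lra.

Import Order.TTheory GRing.Theory Num.Theory.
Import numFieldNormedType.Exports.

Local Open Scope classical_set_scope.
Local Open Scope ring_scope.

(** For [i = 1, 2] let [c_i] be the inverse image of [b] under [Psi_(a_i)], and put
    [h_1 = (1 - c_1 a_1)^-1] and [h_2 = (1 - a_2 c_2)^-1]; both have expectation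
    [1 + b].  With [k = b^-1 (1 + b)], [r = (h_1 - (1 + b)) (1 + b)^-1] and
    [p = (h_2 - (1 + b)) b^-1] one has the factorization
    [1 - k c_1 a_1 a_2 c_2 = k h_1^-1 (1 - r p) b h_2^-1],
    so that [(1 - k c_1 a_1 a_2 c_2)^-1 = (k + p) (sum_n (r p)^n) (1 + r) b].
    Since [r] and [p] are limits of centered elements of [alg(B, a_1)] and
    [alg(B, a_2)], freeness kills every alternating word and the expectation of
    this inverse is [k b = 1 + b].  Conjugating by [c_2] gives
    [Psi_(a_1 a_2) (k c_1 c_2) = b], which is the multiplicativity of [S].
    The hypotheses on [`|b|] make all these series converge and put [k c_1 c_2]
    in the ball where [Psi_(a_1 a_2)] is injective, because
    [c_i = b E(a_i)^-1 v_i] with [`|v_i| <= 19/16]. *)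

(** * Real-valued norm and limits *)

Section RealNorm.
Context {R : realType} {A : banachAlg R[i]}.
Implicit Types (x y : A) (u v : nat -> A).

(* Norms lie in [R[i]], which is only partially ordered; [rnorm] is the same
   number seen in [R], so that real arithmetic applies. *)
Definition rnorm x : R := complex.Re `|x|.

Lemma normE x : `|x| = (rnorm x)%:C%C.
Proof. by rewrite /rnorm RRe_real// ger0_real. Qed.

Lemma rnorm_ge0 x : 0 <= rnorm x.
Proof. by rewrite -ler0c -normE. Qed.

Lemma rnormD x y : rnorm (x + y) <= rnorm x + rnorm y.
Proof. by rewrite -lecR rmorphD/= -!normE ler_normD. Qed.

Lemma rnormN x : rnorm (- x) = rnorm x.
Proof. by rewrite /rnorm normrN. Qed.

Lemma rnormB x y : rnorm (x - y) <= rnorm x + rnorm y.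
Proof. by rewrite -(rnormN y) rnormD. Qed.

Lemma rnormBC x y : rnorm (x - y) = rnorm (y - x).
Proof. by rewrite -rnormN opprB. Qed.

Lemma rnormM x y : rnorm (x * y) <= rnorm x * rnorm y.
Proof. by rewrite -lecR rmorphM/= -!normE; exact: ba_normM. Qed.

Lemma rnorm0 : rnorm 0 = 0.
Proof. by rewrite /rnorm normr0. Qed.

Lemma rnorm1 : rnorm 1 = 1.
Proof. by rewrite /rnorm [X in complex.Re X](@ba_norm1 _ A). Qed.

Lemma rnorm_le0 x : rnorm x <= 0 -> x = 0.
Proof.
move=> x0; have /eqP x0' : rnorm x == 0 by rewrite eq_le x0 rnorm_ge0.
by apply/eqP; rewrite -normr_eq0 normE x0'.
Qed.

Lemma rnorm_gt0 x : (0 < rnorm x) = (x != 0).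
Proof.
apply/idP/idP => [|x0]; first by apply: contraTneq => ->; rewrite rnorm0 ltxx.
by rewrite ltNge; apply: contraNN x0 => /rnorm_le0 ->.
Qed.

Lemma rnormX x n : rnorm (x ^+ n) <= rnorm x ^+ n.
Proof.
elim: n => [|n ih]; first by rewrite !expr0 rnorm1.
by rewrite !exprS (le_trans (rnormM _ _))// ler_wpM2l ?rnorm_ge0.
Qed.

(** A positive element of [R[i]] is real, so the radii that define convergence in [A] can be taken
    in [R]. *)
Lemma cvg_rnormP u l :
  u @ \oo --> l <-> (fun n => rnorm (u n - l)) @ \oo --> (0 : R).
Proof.
split=> [/cvgrPdist_lt ul|/cvgrPdist_lt ul]; apply/cvgrPdist_lt => e e0.
  have /ul : 0 < e%:C%C by rewrite -[0]/((0:R)%:C%C) ltcR.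
  apply: filterS => n; rewrite normE ltcR rnormBC sub0r normrN ger0_norm//.
  exact: rnorm_ge0.
have er : e \is Num.real by rewrite ger0_real// ltW.
move: e0; rewrite -(RRe_real er) -[0]/((0:R)%:C%C) ltcR => /ul.
apply: filterS => n; rewrite sub0r normrN ger0_norm ?rnorm_ge0//.
by rewrite normE rnormBC ltcR.
Qed.

Lemma rnorm_squeeze {u l} (v : nat -> R) :
  (forall n, rnorm (u n - l) <= v n) -> v @ \oo --> 0 -> u @ \oo --> l.
Proof.
move=> uv v0; apply/cvg_rnormP.
apply: (@squeeze_cvgr _ _ _ _ (fun=> 0) v) => //; last exact: cvg_cst.
by near=> n; rewrite rnorm_ge0 uv.
Unshelve. all: by end_near. Qed.

Lemma cvg_unique_seq {u x y} : u @ \oo --> x -> u @ \oo --> y -> x = y.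
Proof.
by move=> ux uy; apply: (@cvg_unique A _ (u @ \oo)) => //; exact: norm_hausdorff.
Qed.

Lemma cvg_mulr_seq {u v x y} : u @ \oo --> x -> v @ \oo --> y ->
  (fun n => u n * v n) @ \oo --> x * y.
Proof.
move=> /cvg_rnormP ux /cvg_rnormP vy.
apply: (@rnorm_squeeze _ _ (fun n => rnorm (u n - x) * rnorm (v n - y) +
  (rnorm (u n - x) * rnorm y + rnorm x * rnorm (v n - y)))) => [n|].
  have -> : u n * v n - x * y =
    (u n - x) * (v n - y) + ((u n - x) * y + x * (v n - y)).
    by rewrite addrA -mulrDr subrK mulrBl mulrBr addrA subrK.
  apply: (le_trans (rnormD _ _)); apply: lerD; first exact: rnormM.
  by apply: (le_trans (rnormD _ _)); apply: lerD; exact: rnormM.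
rewrite -[X in _ --> X](_ : 0 * 0 + (0 * rnorm y + rnorm x * 0) = 0);
  last by ring.
apply: cvgD; first exact: cvgM.
by apply: cvgD; apply: cvgM => //; exact: cvg_cst.
Qed.

Lemma cvg_contractive {f : {linear A -> A}} {u x} :
  (forall x, `|f x| <= `|x|) -> u @ \oo --> x -> (fun n => f (u n)) @ \oo --> f x.
Proof.
move=> fle /cvg_rnormP ux.
apply: (@rnorm_squeeze _ _ (fun n => rnorm (u n - x))) => // n.
by rewrite -raddfB -lecR -!normE; exact: fle.
Qed.

Lemma geometric_cvg (q C : R) : 0 <= q < 1 ->
  (fun n => C * q ^+ n) @ \oo --> (0 : R).
Proof. by case/andP=> q0 q1; apply: cvg_geometric; rewrite ger0_norm. Qed.

(** The increments are dominated by a geometric series, so [u] is Cauchy and completeness of [A]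
    applies. *)
Lemma geometric_cauchy_cvg u (q C : R) : 0 <= q < 1 ->
  (forall n, rnorm (u n.+1 - u n) <= C * q ^+ n) -> cvgn u.
Proof.
move=> q01 uq; have /andP[q0 q1] := q01.
have q1' : 0 < 1 - q by rewrite subr_gt0.
have C0 : 0 <= C.
  by have := le_trans (rnorm_ge0 _) (uq 0%N); rewrite expr0 mulr1.
(* The right-hand side is the closed form of [C * (q ^+ m + ... + q ^+ (m + k - 1))]. *)
have tele m k : rnorm (u (m + k)%N - u m) <= C * q ^+ m / (1 - q) * (1 - q ^+ k).
  elim: k => [|k ih]; first by rewrite addn0 subrr rnorm0 expr0 subrr mulr0.
  rewrite addnS -(subrK (u (m + k)%N) (u (m + k).+1)) -addrA.
  apply: (le_trans (rnormD _ _)); apply: (le_trans (lerD (uq _) ih)).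
  rewrite exprD exprS le_eqVlt; apply/orP; left; apply/eqP.
  by field; rewrite gt_eqF.
apply: cauchy_cvg; apply: cauchy_exP => e e0.
have er : e \is Num.real by rewrite ger0_real// ltW.
move: e0; rewrite -(RRe_real er) -[0]/((0:R)%:C%C) ltcR => e0.
have /cvgrPdist_lt/(_ _ e0)[M _ Mq] := @geometric_cvg q (C / (1 - q)) q01.
exists (u M), M => // n /= Mn.
rewrite -ball_normE/= normE ltcR -(subnKC Mn) rnormBC.
apply: (le_lt_trans (tele M (n - M)%N)).
have := Mq M (leqnn _); rewrite sub0r normrN ger0_norm; last first.
  by rewrite mulr_ge0 ?exprn_ge0// divr_ge0// ltW.
apply: le_lt_trans; rewrite [C * _ / _]mulrAC ler_piMr//.
  by rewrite mulr_ge0 ?exprn_ge0// divr_ge0// ltW.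
by rewrite gerBl exprn_ge0.
Qed.

(** Banach's fixed point theorem. The closed set [D] also locates the solution, which later keeps
    inverses and preimages inside [B]. *)
Lemma contraction_fixed_point (D : set A) (f : A -> A) (q : R) x0 : 0 <= q < 1 ->
  closed D -> D x0 -> (forall x, D x -> D (f x)) ->
  (forall x y, D x -> D y -> rnorm (f x - f y) <= q * rnorm (x - y)) ->
  exists2 x, D x & f x = x.
Proof.
move=> q01 cD Dx0 fD fq; have /andP[q0 q1] := q01.
pose u n := iter n f x0.
have uD n : D (u n) by elim: n => //= n; exact: fD.
have ucvg : cvgn u.
  apply: (@geometric_cauchy_cvg u q (rnorm (u 1%N - u 0%N)) q01) => n.
  elim: n => [|n ih]; first by rewrite expr0 mulr1.
  by apply: (le_trans (fq _ _ (uD n.+1) (uD n))); rewrite exprS mulrCA ler_wpM2l.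
have Dl : D (limn u) by apply: closed_cvg ucvg => //; exact: nearW.
(* The shifted iterates tend both to [limn u] and to its image under [f]. *)
exists (limn u) => //; apply: (@cvg_unique_seq (fun n => u n.+1)); last first.
  by have := ucvg; rewrite -(cvg_shiftS u).
move/cvg_rnormP : (ucvg); apply: (@rnorm_squeeze) => n /=.
by apply: (le_trans (fq _ _ (uD n) Dl)); rewrite ler_piMl ?rnorm_ge0// ltW.
Qed.

End RealNorm.

(** * Resolvents *)

Section Resolvent.
Context {R : realType} {A : banachAlg R[i]}.
Implicit Types (x y h : A).

(** This is [(1 - x)^-1], with value [0] when [1 - x] has no two-sided inverse. *)
Definition resolvent x : A := xget 0 [set h | (1 - x) * h = 1 /\ h * (1 - x) = 1].

Lemma one_sub_fixed_point {D : set A} {x} : rnorm x < 1 -> closed D -> D 1 ->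
  (forall y, D y -> D (1 + x * y)) -> exists2 h, D h & (1 - x) * h = 1.
Proof.
move=> x1 cD D1 DM; have [||||y1 y2 _ _|h Dh he] :=
  @contraction_fixed_point _ _ D (fun y => 1 + x * y) (rnorm x) 1 => //.
- by rewrite rnorm_ge0.
- by rewrite opprD addrACA subrr add0r -mulrBr rnormM.
by exists h => //; rewrite mulrBl mul1r -{1}he addrK.
Qed.

Lemma one_sub_fixed_pointr {x} : rnorm x < 1 -> exists h, h * (1 - x) = 1.
Proof.
move=> x1; have [||||y1 y2 _ _|h _ he] :=
  @contraction_fixed_point _ _ setT (fun y => 1 + y * x) (rnorm x) 1 => //.
- by rewrite rnorm_ge0.
- by rewrite opprD addrACA subrr add0r -mulrBl (le_trans (rnormM _ _))// mulrC.
by exists h; rewrite mulrBr mulr1 -{1}he addrK.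
Qed.

(** Fixed points of [y |-> 1 + x * y] and [y |-> 1 + y * x] give a right and a left inverse, which
    must coincide. *)
Lemma resolventP {x} : rnorm x < 1 ->
  (1 - x) * resolvent x = 1 /\ resolvent x * (1 - x) = 1.
Proof.
move=> x1; apply: (@xgetPex _ 0 [set h | (1 - x) * h = 1 /\ h * (1 - x) = 1]).
have [h _ hr] := @one_sub_fixed_point setT x x1 closedT I (fun _ _ => I).
have [g gl] := one_sub_fixed_pointr x1.
have hg : h = g by rewrite -[h]mul1r -gl -(mulrA g) hr mulr1.
by exists h; split=> //; rewrite hg.
Qed.

Lemma resolvent_mem {D : set A} {x} : rnorm x < 1 -> closed D -> D 1 ->
  (forall y, D y -> D (1 + x * y)) -> D (resolvent x).
Proof.
move=> x1 cD D1 DM; have [h Dh hr] := one_sub_fixed_point x1 cD D1 DM.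
suff -> : resolvent x = h by [].
by rewrite -[resolvent x]mulr1 -hr mulrA (resolventP x1).2 mul1r.
Qed.

(** Serves where the inverse comes from an algebraic identity and not from a bound on [x]. *)
Lemma resolvent_unique {x h} : (1 - x) * h = 1 -> h * (1 - x) = 1 -> resolvent x = h.
Proof.
move=> hr hl; have [+ _] :
    (1 - x) * resolvent x = 1 /\ resolvent x * (1 - x) = 1.
  by apply: (@xgetPex _ 0 [set h | (1 - x) * h = 1 /\ h * (1 - x) = 1]); exists h.
by move=> e; rewrite -[LHS]mul1r -hl -mulrA e mulr1.
Qed.

Lemma mul_resolvent {x} : rnorm x < 1 -> x * resolvent x = resolvent x - 1.
Proof.
move=> /resolventP[hr _]; rewrite -[X in _ - X]hr mulrBl mul1r opprB addrC subrK.
by [].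
Qed.

Lemma resolvent_mul {x} : rnorm x < 1 -> resolvent x * x = resolvent x - 1.
Proof.
move=> /resolventP[_ hl]; rewrite -[X in _ - X]hl mulrBr mulr1 opprB addrC subrK.
by [].
Qed.

(** With [h] the resolvent, [h = 1 + x * h] gives [|h| <= 1 + s |h|], which is solved for [|h|]. *)
Lemma rnorm_resolvent {s : R} {x} : rnorm x <= s -> s < 1 ->
  rnorm (resolvent x) <= (1 - s)^-1.
Proof.
move=> xs s1; have x1 := le_lt_trans xs s1.
rewrite -[leRHS]mul1r ler_pdivlMr ?subr_gt0//.
have := rnormD (x * resolvent x) 1.
rewrite mul_resolvent// subrK rnorm1 -mul_resolvent//.
move=> h1; have h2 := rnormM x (resolvent x).
have h3 : rnorm x * rnorm (resolvent x) <= s * rnorm (resolvent x).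
  by rewrite ler_wpM2r ?rnorm_ge0.
by lra.
Qed.

Lemma rnorm_resolventB1 {s : R} {x} : rnorm x <= s -> s < 1 ->
  rnorm (resolvent x - 1) <= s / (1 - s).
Proof.
move=> xs s1; rewrite -mul_resolvent ?(le_lt_trans xs)//.
apply: (le_trans (rnormM _ _)); apply: ler_pM; rewrite ?rnorm_ge0//.
exact: rnorm_resolvent.
Qed.

Lemma sum_geometric {x} n : rnorm x < 1 ->
  \sum_(0 <= i < n) x ^+ i = resolvent x - resolvent x * x ^+ n.
Proof.
move=> x1; rewrite big_mkord -[LHS]mul1r -(resolventP x1).2 -mulrA -[1 - x]opprB.
by rewrite mulNr -subrX1 opprB mulrBr mulr1.
Qed.

Lemma exp_cvg0 {x} : rnorm x < 1 -> (fun n => x ^+ n) @ \oo --> (0 : A).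
Proof.
move=> x1; apply: (@rnorm_squeeze _ _ _ _ (fun n => 1 * rnorm x ^+ n)).
  by move=> n; rewrite subr0 mul1r rnormX.
by apply: geometric_cvg; rewrite rnorm_ge0.
Qed.

Lemma geometric_cvg_resolvent {x} : rnorm x < 1 ->
  (fun n => \sum_(0 <= i < n) x ^+ i) @ \oo --> resolvent x.
Proof.
move=> x1; under eq_fun do rewrite (sum_geometric _ x1).
suff : (fun n => resolvent x - resolvent x * x ^+ n) @ \oo -->
    resolvent x - resolvent x * 0 by rewrite mulr0 subr0.
apply: cvgB; first exact: cvg_cst.
by apply: cvg_mulr_seq; [exact: cvg_cst|exact: exp_cvg0].
Qed.

Lemma resolventB {x y} : rnorm x < 1 -> rnorm y < 1 ->
  resolvent x - resolvent y = resolvent x * (x - y) * resolvent y.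
Proof.
move=> /resolventP[_ hx] /resolventP[hy _].
have -> : x - y = (1 - y) - (1 - x) by rewrite opprB [RHS]addrC addrA subrK.
by rewrite mulrBr mulrBl -mulrA hy hx mulr1 mul1r.
Qed.

(** Removing the linear term leaves, in the resolvent identity, a factor [resolvent - 1] of order
    [s] in each summand; the Lipschitz constant is therefore small with [s]. *)
Lemma resolvent_tail_lipschitz {s : R} {x y} :
  rnorm x <= s -> rnorm y <= s -> s < 1 ->
  rnorm ((resolvent x - x) - (resolvent y - y)) <=
    (s / (1 - s) / (1 - s) + s / (1 - s)) * rnorm (x - y).
Proof.
move=> xs ys s1; have x1 := le_lt_trans xs s1; have y1 := le_lt_trans ys s1.
have -> : (resolvent x - x) - (resolvent y - y) =
    (resolvent x - 1) * (x - y) * resolvent y + (x - y) * (resolvent y - 1).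
  rewrite [(_ - 1) * _]mulrBl mul1r (mulrBl (resolvent y)) -resolventB//.
  by rewrite mulrBr mulr1 addrA subrK !opprB ![y - _]addrC addrACA.
have s0 : 0 <= s := le_trans (rnorm_ge0 _) xs.
have t0 : 0 <= s / (1 - s) by rewrite divr_ge0// subr_ge0 ltW.
rewrite [leRHS]mulrDl; apply: (le_trans (rnormD _ _)); apply: lerD.
  rewrite [leRHS]mulrAC.
  apply: (le_trans (rnormM _ _)); apply: ler_pM; rewrite ?rnorm_ge0//.
    apply: (le_trans (rnormM _ _)); apply: ler_pM; rewrite ?rnorm_ge0//.
    exact: rnorm_resolventB1.
  exact: rnorm_resolvent.
rewrite [leRHS]mulrC; apply: (le_trans (rnormM _ _)).
by rewrite ler_wpM2l ?rnorm_ge0// rnorm_resolventB1.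
Qed.

(** Conjugation by [b] turns [1 - b * x] into [1 - x * b]. *)
Lemma resolvent_conj {x b c} : rnorm (b * x) < 1 -> c * b = 1 -> b * c = 1 ->
  resolvent (x * b) = c * resolvent (b * x) * b.
Proof.
move=> /resolventP[hr hl] cb bc.
have -> : x * b = c * (b * x) * b by rewrite mulrA cb mul1r.
have e : 1 - c * (b * x) * b = c * (1 - b * x) * b by rewrite mulrBr mulrBl mulr1 cb.
apply: resolvent_unique; rewrite e.
  by rewrite -!mulrA (mulrA b) bc mul1r (mulrA (1 - _)) hr mul1r.
by rewrite -!mulrA (mulrA b) bc mul1r (mulrA (resolvent _)) hl mul1r.
Qed.

End Resolvent.

(** * Closed form of [Psi] *)

Section Psi.
Context {R : realType} {A : banachAlg R[i]} (E : {linear A -> A}).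
Hypothesis E1 : E 1 = 1.
Hypothesis Ele : forall x, `|E x| <= `|x|.

Lemma PsiE {a b} : rnorm (b * a) < 1 -> Psi E a b = E (resolvent (b * a)) - 1.
Proof.
move=> x1; rewrite /Psi -[X in _ - X]E1 -raddfB.
apply: cvg_lim; first exact: norm_hausdorff.
have -> : (fun n => \big[+%R/0]_(1 <= i < n) E ((b * a) ^+ i)) =
    (fun n => E (\sum_(1 <= i < n) (b * a) ^+ i)).
  by apply/funext => n; rewrite raddf_sum.
(* After a shift by one the range is never empty, so the term of index [0], equal to [1], can be
   split off. *)
apply: cvg_contractive => //; rewrite -(cvg_shiftS (fun n => \sum_(1 <= i < n) _)) /=.
have -> : (fun n => \sum_(1 <= i < n.+1) (b * a) ^+ i) =
    (fun n => \sum_(0 <= i < n.+1) (b * a) ^+ i - 1).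
  by apply/funext => n; rewrite [in RHS]big_ltn// expr0 addrC addKr.
apply: cvgB; last exact: cvg_cst.
rewrite (cvg_shiftS (fun n => \sum_(0 <= i < n) _)).
exact: geometric_cvg_resolvent.
Qed.

End Psi.

(** * Inverting Psi *)

Lemma closed_rnorm_le {R : realType} {A : banachAlg R[i]} (r : R) :
  closed [set x : A | rnorm x <= r].
Proof.
move=> p cp /=; rewrite leNgt; apply/negP => rp.
have e0 : 0 < (rnorm p - r)%:C%C by rewrite -[0]/((0:R)%:C%C) ltcR subr_gt0.
have [y [/= yr]] := cp _ (nbhsx_ballx p _ e0).
rewrite -ball_normE/= normE ltcR => py.
by have := rnormD (p - y) y; rewrite subrK; lra.
Qed.

(** * Subalgebras, generated algebras and inverses in [B] *)

Section Subalgebra.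
Context {K : numFieldType} {A : banachAlg K} {P : set A}.
Hypothesis hP : subalgebra P.

Lemma subalg1 : P 1.
Proof. by case: hP; rewrite inE. Qed.

Lemma subalgM x y : P x -> P y -> P (x * y).
Proof. by case: hP => _ _ PM Px Py; apply/set_mem/PM; rewrite inE. Qed.

Lemma subalgZD k x y : P x -> P y -> P (k *: x + y).
Proof. by case: hP => _ PZ _ Px Py; apply/set_mem/PZ; rewrite inE. Qed.

Lemma subalgD x y : P x -> P y -> P (x + y).
Proof. by move=> Px Py; have := subalgZD 1 _ _ Px Py; rewrite scale1r. Qed.

Lemma subalg0 : P 0.
Proof. by have := subalgZD (-1) _ _ subalg1 subalg1; rewrite scaleN1r addNr. Qed.

Lemma subalgN x : P x -> P (- x).
Proof.
by move=> Px; have := subalgZD (-1) _ _ Px subalg0; rewrite scaleN1r addr0.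
Qed.

Lemma subalgB x y : P x -> P y -> P (x - y).
Proof. by move=> Px /subalgN; exact: subalgD. Qed.

Lemma subalgX x n : P x -> P (x ^+ n).
Proof.
move=> Px; elim: n => [|n ih]; first by rewrite expr0; exact: subalg1.
by rewrite exprS; exact: subalgM.
Qed.

Lemma subalg_sum (F : nat -> A) n :
  (forall i, P (F i)) -> P (\sum_(0 <= i < n) F i).
Proof. by move=> PF; apply: big_ind => // [|x y]; [exact: subalg0|exact: subalgD]. Qed.

End Subalgebra.

Section GenAlg.
Context {K : numFieldType} {A : banachAlg K} {B : set A} {a : A}.

Lemma gen_alg_subalgebra : subalgebra (gen_alg B a).
Proof.
split => [|k x y|x y].
- by rewrite inE => M [/subalg1].
- by rewrite !inE => gx gy M [hM BM]; apply: subalgZD => //; [exact: gx|exact: gy].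
- by rewrite !inE => gx gy M [hM BM]; apply: subalgM => //; [exact: gx|exact: gy].
Qed.

Lemma gen_alg_base b : B b -> gen_alg B a b.
Proof. by move=> Bb M [_ BM]; apply: BM; left. Qed.

Lemma gen_alg_gen : gen_alg B a a.
Proof. by move=> M [_ BM]; apply: BM; right. Qed.

End GenAlg.

Section InverseIn.
Context {K : numFieldType} {A : banachAlg K} {B : set A}.

Lemma inv_inP {b} : invertible_in B b -> is_inverse_in B b (inv_in B b).
Proof.
by move=> [_ hb]; apply: (@xgetPex _ 0 [set c | is_inverse_in B b c]).
Qed.

Lemma inv_in_unique {b c} : is_inverse_in B b c -> inv_in B b = c.
Proof.
move=> bc; have [_ _ h] : is_inverse_in B b (inv_in B b).
  by apply: (@xgetPex _ 0 [set c | is_inverse_in B b c]); exists c.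
by case: bc => _ bc _; rewrite -[LHS]mulr1 -bc mulrA h mul1r.
Qed.

End InverseIn.

(** * Injectivity and local inversion of [Psi] by contraction *)

Section PsiInverse.
Context {R : realType} {A : banachAlg R[i]} {B : set A} {E : {linear A -> A}}.
Hypothesis hB : comm_banach_subalgebra B.
Hypothesis hE : cond_expectation B E.

Let subB : subalgebra B := cbs_subalgebra hB.
Let mulC := cbs_comm hB.

Lemma cexp1 : E 1 = 1.
Proof. by apply: (cexp_id hE); exact: subalg1. Qed.

Lemma cexp_mull b x : B b -> E (b * x) = b * E x.
Proof.
move=> Bb; have := cexp_bimod hE x Bb (subalg1 subB).
by rewrite !mulr1.
Qed.

Lemma cexp_mulr b x : B b -> E (x * b) = E x * b.
Proof.
move=> Bb; have := cexp_bimod hE x (subalg1 subB) Bb.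
by rewrite !mul1r.
Qed.

Lemma rnorm_cexp x : rnorm (E x) <= rnorm x.
Proof. by rewrite -lecR -!normE (cexp_norm hE). Qed.

Lemma resolvent_mem_base x : rnorm x < 1 -> B x -> B (resolvent x).
Proof.
move=> x1 Bx; apply: (resolvent_mem x1 (cbs_closed hB)); first exact: subalg1.
by move=> y By; apply: subalgD => //; [exact: subalg1|exact: subalgM].
Qed.

Context {a : A} (a0 : a != 0) (hEa : invertible_in B (E a)).
Let m := inv_in B (E a).
Let al := rnorm a.
Let mu := rnorm m.

Let al_gt0 : 0 < al.
Proof. by rewrite rnorm_gt0. Qed.

Let Bm : B m.
Proof. by have [] := inv_inP hEa. Qed.

Let mEa : m * E a = 1.
Proof. by have [] := inv_inP hEa. Qed.

Let Eam : E a * m = 1.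
Proof. by have [] := inv_inP hEa. Qed.

(** [1 = E a * m] and [E] is contractive. This lower bound drives all later numerical estimates. *)
Lemma rnorm_mul_inv_cexp_ge1 : 1 <= rnorm a * rnorm (inv_in B (E a)).
Proof.
rewrite -(@rnorm1 _ A) -Eam; apply: (le_trans (rnormM _ _)).
by rewrite ler_wpM2r ?rnorm_ge0// rnorm_cexp.
Qed.

Let mu_gt0 : 0 < mu.
Proof.
have := rnorm_mul_inv_cexp_ge1; rewrite -/m -/al -/mu => h.
by rewrite -(pmulr_rgt0 _ al_gt0) (lt_le_trans _ h).
Qed.

Lemma inj_radiusE : inj_radius B E a = ((4 * al ^+ 2 * mu)^-1)%:C%C.
Proof.
by rewrite /inj_radius !normE !expr2 fmorphV !rmorphM/= rmorph_nat.
Qed.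

Lemma S_radiusE : S_radius B E a = ((11 * al ^+ 2 * mu ^+ 2)^-1)%:C%C.
Proof.
by rewrite /S_radius !normE !expr2 fmorphV !rmorphM/= rmorph_nat.
Qed.

Lemma ball_inj_radiusP b : Defs.ball0 B (inj_radius B E a) b <->
  B b /\ rnorm b * (4 * al ^+ 2 * mu) < 1.
Proof.
rewrite /Defs.ball0/= inj_radiusE normE ltcR -div1r ltr_pdivlMr//.
by rewrite !mulr_gt0// exprn_gt0.
Qed.

(* Up to an additive constant, [E a * tail c] is the part of [Psi E a c] of order
   at least 2 in [c]; solving [Psi E a c = b] amounts to finding a fixed point of
   [c |-> m * (1 + b) - tail c]. *)
Let tail (x : A) := m * E (resolvent (x * a) - x * a).

Let small_mul {b} : rnorm b * (4 * al ^+ 2 * mu) <= 1 ->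
  rnorm (b * a) <= (4 * (al * mu))^-1.
Proof.
move=> hb; rewrite -div1r ler_pdivlMr ?mulr_gt0//.
apply: le_trans hb; rewrite -(mulrA 4) expr2.
have -> : rnorm b * (4 * (al * al * mu)) = (rnorm b * al) * (4 * (al * mu)) by ring.
by rewrite ler_wpM2r ?rnormM// !mulr_ge0// ltW.
Qed.

(** Both [b1 * a] and [b2 * a] have norm at most [s = 1 / (4 t)], with [t = al * mu >= 1]. Since
    [s <= 1/4], the resolvent tail has Lipschitz constant at most [28/9 * s]; the factors [m] and
    [a] turn [s] into [t * s = 1/4], leaving [7/9]. *)
Let tail_lipschitz b1 b2 : rnorm b1 * (4 * al ^+ 2 * mu) <= 1 ->
  rnorm b2 * (4 * al ^+ 2 * mu) <= 1 ->
  rnorm (tail b1 - tail b2) <= 7 / 9 * rnorm (b1 - b2).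
Proof.
move=> h1 h2; set t := al * mu.
have t1 : 1 <= t := rnorm_mul_inv_cexp_ge1.
set s := (4 * t)^-1.
have st : t * s = 4^-1 by rewrite /s invfM mulrCA divff ?mulr1//; lra.
have s0 : 0 <= s by rewrite invr_ge0; lra.
have s4 : s <= 4^-1 by rewrite -st ler_peMl.
have s1 : s < 1 by lra.
rewrite /tail -mulrBr -raddfB; apply: (le_trans (rnormM _ _)).
have n1 := resolvent_tail_lipschitz (small_mul h1) (small_mul h2) s1.
have n2 : rnorm (b1 * a - b2 * a) <= rnorm (b1 - b2) * al.
  by rewrite -mulrBl rnormM.
have := le_trans (rnorm_cexp _) n1; rewrite -/t -/s => n3.
have iv0 : 0 <= (1 - s)^-1 by rewrite invr_ge0; lra.
have iv : (1 - s)^-1 <= 4 / 3.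
  by rewrite -div1r ler_pdivrMr; lra.
have k1 : s / (1 - s) <= 4 / 3 * s by rewrite mulrC ler_wpM2r.
have k2 : s / (1 - s) / (1 - s) <= 16 / 9 * s.
  have := ler_wpM2r iv0 k1; have := ler_wpM2l s0 iv; lra.
have k3 : s / (1 - s) / (1 - s) + s / (1 - s) <= 28 / 9 * s by lra.
have k4 := le_trans n3 (ler_pM _ (rnorm_ge0 _) k3 n2).
have -> : 7 / 9 * rnorm (b1 - b2) = mu * (28 / 9 * s * (rnorm (b1 - b2) * al)).
  have -> : mu * (28 / 9 * s * (rnorm (b1 - b2) * al)) =
    28 / 9 * (t * s) * rnorm (b1 - b2) by rewrite /t; ring.
  by rewrite st; field.
rewrite ler_wpM2l ?(ltW mu_gt0)//; apply: k4.
by rewrite addr_ge0// ?mulr_ge0//; lra.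
Qed.

Lemma rnorm_mul_lt1 {b} : rnorm b * (4 * al ^+ 2 * mu) <= 1 -> rnorm (b * a) < 1.
Proof.
move=> /small_mul; move/le_lt_trans; apply.
have := rnorm_mul_inv_cexp_ge1; rewrite -/m -/al -/mu => t1.
by rewrite invf_lt1; lra.
Qed.

(** If the values agree, the tails differ by exactly [- (b1 - b2)], which a [7/9]-Lipschitz map
    allows only for [b1 = b2]. *)
Lemma Psi_inj : {in Defs.ball0 B (inj_radius B E a) &, injective (Psi E a)}.
Proof.
move=> b1 b2; rewrite !inE => /ball_inj_radiusP[Bb1 /ltW n1].
move=> /ball_inj_radiusP[Bb2 /ltW n2].
rewrite !(PsiE _ cexp1 (cexp_norm hE)); try exact: rnorm_mul_lt1.
move=> /addIr e; apply/eqP; rewrite -subr_eq0; apply/eqP/rnorm_le0.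
have := tail_lipschitz _ _ n1 n2.
have -> : tail b1 - tail b2 = - (b1 - b2).
  rewrite /tail -mulrBr ![E (_ - _)]raddfB/= e !cexp_mull//.
  set h := E _; have -> : h - b1 * E a - (h - b2 * E a) = - ((b1 - b2) * E a).
    by rewrite [X in _ + X]opprB addrC subrKA mulrBl opprB.
  have BEa := cexp_mem hE a.
  have BbE : B ((b1 - b2) * E a) by apply: (subalgM subB) => //; exact: (subalgB subB).
  by rewrite mulrN (mulC _ _ Bm BbE) -mulrA Eam mulr1.
by rewrite rnormN => h; have := rnorm_ge0 (b1 - b2); lra.
Qed.

(** The partial inverse picks some preimage in the ball; injectivity makes it [c]. *)
Lemma Psi_inv_unique b c : B c -> rnorm c * (4 * al ^+ 2 * mu) < 1 ->
  E (resolvent (c * a)) = 1 + b -> Psi_inv B E a b = c.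
Proof.
move=> Bc nc ec.
have <- : Psi E a c = b.
  rewrite (PsiE _ cexp1 (cexp_norm hE)); first by rewrite ec addrC addKr.
  exact/rnorm_mul_lt1/ltW.
by apply: (pinvKV _ Psi_inj); rewrite inE; apply/ball_inj_radiusP.
Qed.

(* [3 / 22] is chosen so that, with [q = `|a| * `|E(a)^-1|], the ball where
   [`|c| * `|a| <= 3 / (22 q)] is stable under the contraction. *)
Lemma Psi_inv_solution b : B b -> rnorm b * (11 * al ^+ 2 * mu ^+ 2) < 1 ->
  exists c v, [/\ [/\ B c, c = b * m * v & rnorm c * al <= 3 / 22],
    B v /\ rnorm v <= 19 / 16, exists2 v', B v' & v * v' = 1,
    Psi_inv B E a b = c & E (resolvent (c * a)) = 1 + b].
Proof.
move=> Bb nb; set t := al * mu.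
have t1 : 1 <= t := rnorm_mul_inv_cexp_ge1.
set tau : R := 3 / 22 / (al ^+ 2 * mu).
have am0 : 0 < al ^+ 2 * mu by rewrite mulr_gt0// exprn_gt0.
have tauE : tau * (al ^+ 2 * mu) = 3 / 22 by rewrite /tau divfK ?gt_eqF.
have tau0 : 0 <= tau by rewrite /tau divr_ge0// ltW.
set s := tau * al.
have s0 : 0 <= s by rewrite mulr_ge0// ltW.
have st : s * t = 3 / 22 by rewrite -tauE /s /t; ring.
have s3 : s <= 3 / 22 by rewrite -st ler_peMr.
have s1 : s < 1 by lra.
have iv : s / (1 - s) <= 22 / 19 * s.
  rewrite mulrC ler_wpM2r// -div1r ler_pdivrMr; lra.
have iv0 : 0 <= s / (1 - s) by rewrite divr_ge0//; lra.
(* The ball of radius [tau] lies well inside the injectivity ball, as [4 * 3/22 = 12/22]. *)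
have tau1 (c : A) : rnorm c <= tau -> rnorm c * (4 * al ^+ 2 * mu) <= 12 / 22.
  move=> /(ler_wpM2r (ltW am0)); rewrite tauE => h.
  by rewrite -mulrA mulrCA; lra.
have ctau c : rnorm c <= tau -> rnorm (c * a) <= s.
  by move=> h; rewrite (le_trans (rnormM _ _))// ler_wpM2r// ltW.
(* The hypothesis on [b] gives [1/11] for the left side times [al ^+ 2 * mu], and
   [1/11 = 2/3 * 3/22]. *)
have nmb : mu * rnorm b <= 2 / 3 * tau.
  rewrite -(ler_pM2r am0) -[leRHS]mulrA tauE.
  move: nb; have -> : rnorm b * (11 * al ^+ 2 * mu ^+ 2) =
    11 * (mu * rnorm b * (al ^+ 2 * mu)) by ring.
  by lra.
pose F c := m * (1 + b) - tail c.
pose D := B `&` [set c : A | rnorm c <= tau].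
have [||||c1 c2 [Bc1 n1] [Bc2 n2]|c [Bc nc] Fc] :=
  @contraction_fixed_point R A D F (7 / 9) 0.
- by apply/andP; split; lra.
- by apply: closedI; [exact: (cbs_closed hB)|exact: closed_rnorm_le].
- by split; [exact: (subalg0 subB)|rewrite /= rnorm0].
- move=> c [Bc nc]; split.
    apply: (subalgB subB).
      by apply: (subalgM subB) => //; apply: (subalgD subB) => //; exact: subalg1.
    by apply: (subalgM subB) => //; exact: (cexp_mem hE).
  have x1 : rnorm (c * a) < 1 by apply: (le_lt_trans (ctau _ nc)).
  (* The constant and linear terms cancel, so what accompanies [b] is quadratic in [c]. It
     contributes at most [3/19 * tau], and [2/3 + 3/19 < 1] gives stability. *)
  have -> : F c = m * (b - E (c * a * (resolvent (c * a) - 1))).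
    rewrite [c * a * _]mulrBr mulr1 mul_resolvent// /F /tail -mulrBr; congr (m * _).
    rewrite [E (_ - 1 - _)]raddfB/= [E (_ - 1)]raddfB/= [E (_ - _)]raddfB/=.
    by rewrite cexp1 [_ - 1 - _]addrAC [- (_ - 1)]opprB [RHS]addrA (addrC b).
  rewrite /=; apply: (le_trans (rnormM _ _)).
  have h1 : rnorm (E (c * a * (resolvent (c * a) - 1))) <= s * (s / (1 - s)).
    apply: (le_trans (rnorm_cexp _)); apply: (le_trans (rnormM _ _)).
    apply: ler_pM; rewrite ?rnorm_ge0 ?ctau//.
    exact: (rnorm_resolventB1 (ctau _ nc)).
  have h2 := rnormB b (E (c * a * (resolvent (c * a) - 1))).
  have h3 : s * (s / (1 - s)) <= s * (22 / 19 * s) by rewrite ler_wpM2l.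
  have h4 : mu * rnorm (b - E (c * a * (resolvent (c * a) - 1))) <=
    mu * (rnorm b + s * (22 / 19 * s)) by rewrite ler_wpM2l ?(ltW mu_gt0)//; lra.
  have h5 : mu * (s * (22 / 19 * s)) = 22 / 19 * (tau * (s * t)).
    by rewrite /s /t; ring.
  by move: h4; rewrite -/mu [leRHS]mulrDr h5 st; lra.
- have -> : F c1 - F c2 = tail c2 - tail c1 by rewrite /F opprB addrC subrKA.
  have h1 := tau1 _ n1; have h2 := tau1 _ n2.
  by rewrite rnormBC; apply: tail_lipschitz; lra.
have x1 : rnorm (c * a) < 1 by apply: (le_lt_trans (ctau _ nc)).
have Ec : E (resolvent (c * a)) = 1 + b.
  have := congr1 (fun z => E a * z) Fc.
  rewrite /F /tail -mulrBr mulrA Eam mul1r raddfB/=.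
  rewrite cexp_mull// (mulC _ _ Bc (cexp_mem hE a)).
  by rewrite opprB addrA => /eqP; rewrite subr_eq [_ + E a * c]addrC => /eqP/addrI.
pose h := resolvent (c * a).
have nh : rnorm (h - 1) <= s / (1 - s) by exact: (rnorm_resolventB1 (ctau _ nc)).
(* From [b = c * E (a * h) = c * E a * w] comes [c = b * m * v] with [v] the inverse of [w]; and
   [|1 - w| <= 3/19] gives [|v| <= 19/16]. *)
pose w := m * E (a * h).
have nw : rnorm (1 - w) <= 3 / 19.
  have -> : 1 - w = - (m * E (a * (h - 1))).
    by rewrite mulrBr mulr1 [E _]raddfB mulrBr mEa opprB.
  rewrite rnormN; apply: (le_trans (rnormM _ _)).
  have h1 : rnorm (E (a * (h - 1))) <= al * (22 / 19 * s).
    apply: (le_trans (rnorm_cexp _)); apply: (le_trans (rnormM _ _)).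
    by rewrite ler_wpM2l ?(ltW al_gt0)// (le_trans nh).
  apply: (le_trans (ler_wpM2l (ltW mu_gt0) h1)).
  have -> : mu * (al * (22 / 19 * s)) = 22 / 19 * (s * t) by rewrite /t; ring.
  by rewrite st; lra.
have nw1 : rnorm (1 - w) < 1 by lra.
have Bw : B w by apply: (subalgM subB) => //; exact: (cexp_mem hE).
have [vr vl] := resolventP nw1.
rewrite opprB addrC subrK in vr vl.
exists c, (resolvent (1 - w)); split => //.
- split => //; last by rewrite (le_trans _ s3)// ler_wpM2r// ltW.
  rewrite -[LHS]mulr1 -[X in c * X]vr mulrA; congr (_ * _).
  have -> : b = c * E (a * h).
    by rewrite -cexp_mull// mulrA mul_resolvent// raddfB/= Ec cexp1 addrC addKr.
  by rewrite /w -mulrA (mulC m)//; exact: (cexp_mem hE).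
- split.
    apply: resolvent_mem_base => //.
    by apply: (subalgB subB) => //; exact: subalg1.
  by apply: (le_trans (rnorm_resolvent nw _)); [lra|rewrite -div1r ler_pdivrMr; lra].
- by exists w.
- by apply: Psi_inv_unique => //; have := tau1 _ nc; lra.
Qed.

End PsiInverse.

(** * Freeness for limits *)

Section Freeness.
Context {R : realType} {A : banachAlg R[i]} {B : set A} {E : {linear A -> A}}.
Hypothesis hB : comm_banach_subalgebra B.
Hypothesis hE : cond_expectation B E.

Let subB : subalgebra B := cbs_subalgebra hB.

(** [gen_alg] need not be closed, so resolvents are reached only as limits. The approximants
    themselves are centered, since freeness is applied to them. *)
Definition centered_limit (a x : A) : Prop :=
  exists2 y : nat -> A, (forall n, gen_alg B a (y n) /\ E (y n) = 0) &
    y @ \oo --> x.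

Lemma cexp_center x : E (x - E x) = 0.
Proof. by rewrite raddfB/= (cexp_id hE (cexp_mem hE x)) subrr. Qed.

Lemma centered_limit_gen a x : gen_alg B a x -> centered_limit a (x - E x).
Proof.
move=> gx; exists (fun=> x - E x); last exact: cvg_cst.
move=> n; split; last exact: cexp_center.
apply: (subalgB gen_alg_subalgebra) => //; apply: gen_alg_base; exact: (cexp_mem hE).
Qed.

Lemma centered_limit_mulr a x d : B d -> centered_limit a x ->
  centered_limit a (x * d).
Proof.
move=> Bd [y hy yx]; exists (fun n => y n * d).
  move=> n; have [gy Ey] := hy n; split; last by rewrite (cexp_mulr hB hE)// Ey mul0r.
  by apply: (subalgM gen_alg_subalgebra) => //; exact: gen_alg_base.
by apply: cvg_mulr_seq => //; exact: cvg_cst.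
Qed.

(** The partial geometric sums are centered one by one; continuity of [E] gives the limit. *)
Lemma centered_limit_resolvent a z : gen_alg B a z -> rnorm z < 1 ->
  centered_limit a (resolvent z - E (resolvent z)).
Proof.
move=> gz z1; pose S n := \sum_(0 <= i < n) z ^+ i.
have gS n : gen_alg B a (S n).
  apply: (subalg_sum gen_alg_subalgebra) => i.
  exact: (subalgX gen_alg_subalgebra).
exists (fun n => S n - E (S n)).
  move=> n; split; last exact: cexp_center.
  apply: (subalgB gen_alg_subalgebra) => //; apply: gen_alg_base; exact: (cexp_mem hE).
have Sz := geometric_cvg_resolvent z1.
by apply: cvgB => //; apply: cvg_contractive => //; exact: (cexp_norm hE).
Qed.

Context {a1 a2 : A} (hfree : free_over B E a1 a2).

Lemma free_over_limit (n : nat) (i : nat -> bool) (x : nat -> A) : (0 < n)%N ->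
  (forall j, (j.+1 < n)%N -> i j != i j.+1) ->
  (forall j, (j < n)%N -> centered_limit (if i j then a2 else a1) (x j)) ->
  E (\prod_(0 <= j < n) x j) = 0.
Proof.
move=> n0 alt xc.
(* Past the length of the word any sequence will do; [0] makes the family total. *)
have /choice[y hy] : forall j, exists y : nat -> A, (j < n)%N ->
    (forall k, gen_alg B (if i j then a2 else a1) (y k) /\ E (y k) = 0) /\
    y @ \oo --> x j.
  move=> j; case: (ltnP j n) => [/xc[y h1 h2]|]; first by exists y.
  by exists (fun=> 0).
have cv : forall N, (N <= n)%N ->
    (fun k => \prod_(0 <= j < N) y j k) @ \oo --> \prod_(0 <= j < N) x j.
  elim=> [_|N ih Nn].
    rewrite big_nil; under eq_fun do rewrite big_nil; exact: cvg_cst.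
  rewrite big_nat_recr//=; under eq_fun do rewrite big_nat_recr//=.
  by apply: cvg_mulr_seq; [exact/ih/ltnW|exact: (hy _ Nn).2].
apply: (cvg_unique_seq (cvg_contractive (cexp_norm hE) (cv _ (leqnn n)))).
have -> : (fun k => E (\prod_(0 <= j < n) y j k)) = (fun=> 0).
  apply/funext => k; apply: (hfree n i (fun j => y j k)) => // j jn.
    exact: ((hy j jn).1 k).1.
  exact: ((hy j jn).1 k).2.
exact: cvg_cst.
Qed.

Context {r p : A} (hr : centered_limit a1 r) (hp : centered_limit a2 p).

(** Alternating letters; [e] selects the first one, [r] for [false] and [p] for [true]. *)
Let word (e : bool) j := if odd j (+) e then p else r.

Let free_word e n : (0 < n)%N -> E (\prod_(0 <= j < n) word e j) = 0.
Proof.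
move=> n0; apply: (free_over_limit n (fun j => odd j (+) e)) => //.
  by move=> j _ /=; case: (odd j); case: e.
by move=> j _; rewrite /word; case: ifP.
Qed.

Let word_rp n : \prod_(0 <= j < n.*2) word false j = (r * p) ^+ n.
Proof.
elim: n => [|n ih]; first by rewrite big_nil expr0.
by rewrite doubleS !big_nat_recr//= ih exprSr mulrA /word /= odd_double.
Qed.

Let word_prp n : \prod_(0 <= j < n.*2.+1) word true j = p * (r * p) ^+ n.
Proof.
rewrite big_nat_recl//= -word_rp; congr (_ * _); apply: eq_bigr => j _.
by rewrite /word/= addbT negbK addbF.
Qed.

(** These are the alternating words sorted by first and last letter. Only the first family contains
    the empty word, hence its guard. *)
Lemma free_alternating n : [/\ (0 < n)%N -> E ((r * p) ^+ n) = 0,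
  E ((r * p) ^+ n * r) = 0, E (p * (r * p) ^+ n) = 0 &
  E (p * (r * p) ^+ n * r) = 0].
Proof.
split.
- by move=> n0; rewrite -word_rp free_word// double_gt0.
- have := @free_word false n.*2.+1 isT.
  by rewrite big_nat_recr//= word_rp /word odd_double.
- by rewrite -word_prp free_word.
- have := @free_word true n.*2.+2 isT.
  by rewrite big_nat_recr//= word_prp /word/= odd_double.
Qed.

(** Expanding [(k + p) * (r * p) ^+ n * (1 + r)] yields four terms, each with vanishing expectation
    except [k] itself at [n = 0]. *)
Lemma cexp_alternating_resolvent k : rnorm (r * p) < 1 -> B k ->
  E ((k + p) * resolvent (r * p) * (1 + r)) = k.
Proof.
move=> rp1 Bk.
have term n : E ((k + p) * (r * p) ^+ n * (1 + r)) = if n == 0%N then k else 0.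
  have [h1 h2 h3 h4] := free_alternating n.
  rewrite mulrDl mulrDr mulr1 [X in _ + X]mulrDl raddfD/= [E (_ + _)]raddfD/=.
  rewrite [E (_ * r + _)]raddfD/= -(mulrA k) !(cexp_mull hB hE k _ Bk).
  rewrite h2 h3 h4 mulr0 !addr0.
  case: eqP => [->|/eqP]; first by rewrite expr0 (cexp1 hB hE) mulr1.
  by rewrite -lt0n => /h1 ->; rewrite mulr0.
have cv := geometric_cvg_resolvent rp1.
have cv' : (fun n => (k + p) * (\sum_(0 <= i < n) (r * p) ^+ i) * (1 + r)) @ \oo -->
    (k + p) * resolvent (r * p) * (1 + r).
  apply: cvg_mulr_seq; last exact: cvg_cst.
  by apply: cvg_mulr_seq => //; exact: cvg_cst.
apply: (cvg_unique_seq (cvg_contractive (cexp_norm hE) cv')).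
(* Shifted by one, every partial sum contains the index [0], so the sequence is constantly [k]. *)
rewrite -(cvg_shiftS (fun n => E _)).
have -> : (fun n => E ((k + p) * (\sum_(0 <= i < n.+1) (r * p) ^+ i) * (1 + r)))
    = (fun=> k).
  apply/funext => n; rewrite mulr_sumr mulr_suml raddf_sum/=.
  under eq_bigr do rewrite term.
  rewrite big_nat_recl//= big1 ?addr0//.
exact: cvg_cst.
Qed.

End Freeness.

(** * Expectation of the product of two free elements *)

Section FreeProduct.
Context {R : realType} {A : banachAlg R[i]} {B : set A} {E : {linear A -> A}}.
Hypothesis hB : comm_banach_subalgebra B.
Hypothesis hE : cond_expectation B E.
Context {a1 a2 : A} (hfree : free_over B E a1 a2).

(** Expand the vanishing expectation of [(a1 - E a1) * (a2 - E a2)], the shortest word in two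
    letters. *)
Lemma cexp_free_mul : E (a1 * a2) = E a1 * E a2.
Proof.
have c1 := centered_limit_gen hE a1 a1 gen_alg_gen.
have c2 := centered_limit_gen hE a2 a2 gen_alg_gen.
have [+ _ _ _] := free_alternating hE hfree c1 c2 1.
move=> /(_ isT); rewrite expr1 mulrBl mulrBr [E (_ - _)]raddfB/=.
rewrite [E (_ - a1 * _)]raddfB/=.
have B1 := cexp_mem hE a1; have B2 := cexp_mem hE a2.
rewrite (cexp_mulr hB hE _ a1 B2) (cexp_mull hB hE _ (a2 - E a2) B1).
rewrite (cexp_center hE) mulr0 subr0.
by move=> /eqP; rewrite subr_eq0 => /eqP.
Qed.

End FreeProduct.

(** * The factorization and the resolvent of the product *)

Lemma one_sub_mul_factor {A : pzRingType} {b bi u h1 h2 z1 z2 : A} :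
  b * bi = 1 -> bi * b = 1 -> (1 + b) * u = 1 -> u * (1 + b) = 1 ->
  h1 * z1 = h1 - 1 -> z2 * h2 = h2 - 1 ->
  let k := bi * (1 + b) in
  let r := (h1 - (1 + b)) * u in let p := (h2 - (1 + b)) * bi in
  (h1 * u * b) * (1 - k * z1 * z2) * (h2 * bi) = 1 - r * p.
Proof.
move=> bbi bib bu ub hz1 zh2 k r p.
have kE : k = bi + 1 by rewrite /k mulrDr mulr1 bib.
have bk : b * k = 1 + b by rewrite /k mulrA bbi mul1r.
have q1 : h1 * u = 1 + r by rewrite /r mulrBl bu addrC subrK.
have q2 : h2 * bi = k + p by rewrite /p mulrBl mulrDl mul1r bbi -kE addrC subrK.
have h1E : h1 = (1 + r) * (1 + b) by rewrite -q1 -mulrA ub mulr1.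
have h2E : (h2 - 1) * bi = 1 + p.
  by rewrite mulrBl mul1r q2 kE addrC addrA addrA addNr add0r.
(* With [h1 = (1 + r) * (1 + b)] the left side is [(1 + r) * (1 + b + b * p) - (h1 - 1) * (1 + p)],
   which collapses to [1 + p - (1 + r) * p]. *)
rewrite mulrBr mulr1 mulrBl.
have -> : h1 * u * b * (k * z1 * z2) * (h2 * bi) = (h1 - 1) * (1 + p).
  by rewrite -h2E -zh2 -hz1 -!mulrA (mulrA b) bbi mul1r (mulrA u) ub mul1r.
rewrite q1 q2 -mulrA [b * _]mulrDr bk.
set T := (1 + r) * (1 + b) in h1E.
rewrite h1E mulrDr -/T mulrBl mul1r mulrDr mulr1 {2}/T -mulrA.
have -> : (1 + r) * ((1 + b) * p) = p + r * p + (1 + r) * (b * p).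
  have -> : p + r * p = (1 + r) * p by rewrite mulrDl mul1r.
  by rewrite [(1 + b) * p]mulrDl mul1r mulrDr.
set X := (1 + r) * (b * p).
rewrite (addrC (p + r * p)) addrA opprB opprD addrCA addNKr opprD addrA addrK.
by [].
Qed.

(** Cancelling [M] on the left and [N] on the right of [M * Y * N = Q] gives the inverse [N * g * M]
    of [Y]. *)
Lemma inverse_of_factor {A : pzRingType} {M Mi N Ni Y g Q : A} :
  Mi * M = 1 -> N * Ni = 1 -> M * Y * N = Q -> Q * g = 1 -> g * Q = 1 ->
  Y * (N * g * M) = 1 /\ (N * g * M) * Y = 1.
Proof.
move=> MM NN YQ Qg gQ.
have MY : M * Y = Q * Ni by rewrite -YQ -mulrA NN mulr1.
have YN : Y * N = Mi * Q by rewrite -YQ !mulrA MM mul1r.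
split; first by rewrite !mulrA YN -(mulrA Mi) Qg mulr1.
by rewrite -mulrA MY mulrA -(mulrA N) gQ mulr1.
Qed.

Section ProductResolvent.
Context {R : realType} {A : banachAlg R[i]} {B : set A} {E : {linear A -> A}}.
Hypothesis hB : comm_banach_subalgebra B.
Hypothesis hE : cond_expectation B E.
Context {a1 a2 : A} (hfree : free_over B E a1 a2).

Let subB : subalgebra B := cbs_subalgebra hB.
Let mulC := cbs_comm hB.

(** Elements of [B] need not commute with [a2]. Taking the second resolvent at [a2 * c2] keeps [a1]
    and [a2] adjacent in [c1 * a1 * a2 * c2]; [c2] is brought to the front at the end by
    conjugation. *)
Lemma cexp_resolvent_free_product b bi c1 c2 c2i :
  B b -> is_inverse_in B b bi -> rnorm b < 1 ->
  B c1 -> B c2 -> is_inverse_in B c2 c2i ->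
  rnorm (c1 * a1) < 1 -> rnorm (c2 * a2) < 1 -> rnorm (a2 * c2) < 1 ->
  E (resolvent (c1 * a1)) = 1 + b -> E (resolvent (c2 * a2)) = 1 + b ->
  rnorm ((resolvent (c1 * a1) - (1 + b)) * resolvent (- b) *
         ((resolvent (a2 * c2) - (1 + b)) * bi)) < 1 ->
  rnorm (bi * (1 + b) * c1 * c2 * (a1 * a2)) < 1 ->
  E (resolvent (bi * (1 + b) * c1 * c2 * (a1 * a2))) = 1 + b.
Proof.
move=> Bb [Bbi bbi bib] nb Bc1 Bc2 [Bc2i cc cc'] n1 n2 n2' e1 e2 nrp nc.
have B1 : B 1 := subalg1 subB.
have B1b : B (1 + b) by exact: (subalgD subB).
pose k := bi * (1 + b).
have Bk : B k by exact: (subalgM subB).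
have nNb : rnorm (- b) < 1 by rewrite rnormN.
(* [resolvent (- b)] is the inverse of [1 + b]. *)
have [bu ub] := resolventP nNb; rewrite opprK in bu ub.
have Bu : B (resolvent (- b)).
  by apply: (resolvent_mem_base hB) => //; exact: (subalgN subB).
set u := resolvent (- b) in bu ub Bu nrp *.
(* Conjugation by [c2] fixes the expectation, because [1 + b] commutes with [c2] in [B]. *)
have e2' : E (resolvent (a2 * c2)) = 1 + b.
  rewrite (resolvent_conj n2 cc' cc) (cexp_mulr hB hE _ _ Bc2).
  by rewrite (cexp_mull hB hE _ _ Bc2i) e2 (mulC _ _ Bc2i B1b) -mulrA cc' mulr1.
set h1 := resolvent (c1 * a1) in e1 nrp *.
set h2 := resolvent (a2 * c2) in e2' nrp *.
pose r := (h1 - (1 + b)) * u; pose p := (h2 - (1 + b)) * bi.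
have hr : centered_limit (B := B) (E := E) a1 r.
  apply: (centered_limit_mulr hB hE) => //; rewrite -e1.
  apply: (centered_limit_resolvent hE) => //.
  apply: (subalgM gen_alg_subalgebra); last exact: gen_alg_gen.
  exact: gen_alg_base.
have hp : centered_limit (B := B) (E := E) a2 p.
  apply: (centered_limit_mulr hB hE) => //; rewrite -e2'.
  apply: (centered_limit_resolvent hE) => //.
  apply: (subalgM gen_alg_subalgebra); first exact: gen_alg_gen.
  exact: gen_alg_base.
have [Qg gQ] := resolventP nrp.
have fac := one_sub_mul_factor bbi bib bu ub (resolvent_mul n1) (mul_resolvent n2').
have [hz1 _] := resolventP n1; have [_ zh2] := resolventP n2'.
have kub : k * u * b = 1 by rewrite /k -(mulrA bi) bu mulr1.
have MM : (k * (1 - c1 * a1)) * (h1 * u * b) = 1.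
  by rewrite !mulrA -(mulrA k) hz1 mulr1.
have NN : (h2 * bi) * (b * (1 - a2 * c2)) = 1.
  by rewrite mulrA -(mulrA h2) bib mulr1.
have [Y1 Y2] := inverse_of_factor MM NN fac Qg gQ.
have eX : resolvent (k * c1 * a1 * a2 * c2) =
    (k + p) * resolvent (r * p) * (1 + r) * b.
  have := resolvent_unique Y1 Y2; rewrite -/r -/p.
  have -> : h1 * u = 1 + r by rewrite /r mulrBl bu addrC subrK.
  have -> : h2 * bi = k + p by rewrite /p mulrBl (mulC _ _ B1b Bbi) addrC subrK.
  by set G := resolvent (r * p); rewrite !mulrA.
have eX' : E (resolvent (k * c1 * a1 * a2 * c2)) = 1 + b.
  rewrite eX (cexp_mulr hB hE _ _ Bb).
  rewrite (cexp_alternating_resolvent hB hE hfree hr hp _ nrp Bk).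
  by rewrite (mulC _ _ Bk Bb) /k mulrA bbi mul1r.
have Bk1 : B (k * c1) by exact: (subalgM subB).
have e3 : k * c1 * c2 * (a1 * a2) = c2 * (k * c1 * a1 * a2).
  by rewrite (mulC _ _ Bk1 Bc2) !mulrA.
rewrite -/k e3 in nc *.
move: eX'; rewrite (resolvent_conj nc cc' cc).
rewrite (cexp_mulr hB hE _ _ Bc2) (cexp_mull hB hE _ _ Bc2i).
by rewrite (mulC _ _ Bc2i (cexp_mem hE _)) -[_ * c2i * c2]mulrA cc' mulr1.
Qed.

End ProductResolvent.

(** * Norm estimates for the centered resolvents *)

Section Estimates.
Context {R : realType} {A : banachAlg R[i]}.
Implicit Types a b c m v : A.

Lemma rnorm_mul3 a b c : rnorm (a * b * c) <= rnorm a * rnorm b * rnorm c.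
Proof.
by apply: (le_trans (rnormM _ _)); rewrite ler_wpM2r ?rnorm_ge0// rnormM.
Qed.

(** Split off [b] from [resolvent (c * a) - 1]. The factor [b] in [c] makes the bound linear in
    [|b|]; the constant is [22/19 * 19/16 = 22/16]. *)
Lemma rnorm_resolvent_center {a b c m v} : c = b * m * v ->
  rnorm v <= 19 / 16 -> rnorm c * rnorm a <= 3 / 22 ->
  rnorm (resolvent (c * a) - (1 + b)) <=
    (22 / 16 * (rnorm a * rnorm m) + 1) * rnorm b.
Proof.
move=> cE nv nc; set s := rnorm c * rnorm a in nc.
have s1 : s < 1 by lra.
have h1 := rnorm_resolventB1 (rnormM c a) s1.
rewrite -/s in h1.
have s0 : 0 <= s by rewrite mulr_ge0 ?rnorm_ge0.
have h2 : s / (1 - s) <= 22 / 19 * s.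
  by rewrite mulrC ler_wpM2r// -div1r ler_pdivrMr; lra.
have h3 : rnorm c <= rnorm b * rnorm m * (19 / 16).
  rewrite cE; apply: (le_trans (rnorm_mul3 _ _ _)).
  by rewrite ler_wpM2l ?mulr_ge0 ?rnorm_ge0.
have h4 : s <= rnorm b * rnorm m * (19 / 16) * rnorm a.
  by rewrite ler_wpM2r ?rnorm_ge0.
rewrite opprD addrA; apply: (le_trans (rnormB _ _)).
have -> : (22 / 16 * (rnorm a * rnorm m) + 1) * rnorm b =
  22 / 19 * (rnorm b * rnorm m * (19 / 16) * rnorm a) + rnorm b by field.
by lra.
Qed.

(** The norm of [bi] may be huge, but [c * bi = m * v] cancels it exactly, so the bound depends on
    neither [b] nor [bi]. *)
Lemma rnorm_resolvent_center_div {a b bi c m v} :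
  b * bi = 1 -> c * bi = m * v ->
  rnorm v <= 19 / 16 -> rnorm a * rnorm c <= 3 / 22 ->
  rnorm ((resolvent (a * c) - (1 + b)) * bi) <=
    22 / 16 * (rnorm a * rnorm m) + 1.
Proof.
move=> bbi cbi nv nc.
have s1 : (3 / 22 : R) < 1 by lra.
have n1 := le_trans (rnormM a c) nc.
rewrite opprD addrA -resolvent_mul; last exact: le_lt_trans s1.
have -> : (resolvent (a * c) * (a * c) - b) * bi = resolvent (a * c) * a * (m * v) - 1.
  by rewrite mulrBl bbi -!mulrA cbi.
apply: (le_trans (rnormB _ _)); rewrite rnorm1 lerD2r.
have h1 : rnorm (resolvent (a * c)) <= 22 / 19.
  by apply: (le_trans (rnorm_resolvent n1 s1)); rewrite -div1r ler_pdivrMr; lra.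
have h2 : rnorm (m * v) <= rnorm m * (19 / 16).
  by apply: (le_trans (rnormM _ _)); rewrite ler_wpM2l ?rnorm_ge0.
apply: (le_trans (rnorm_mul3 _ _ _)).
have -> : 22 / 16 * (rnorm a * rnorm m) =
  22 / 19 * rnorm a * (rnorm m * (19 / 16)) by field.
by apply: ler_pM; rewrite ?mulr_ge0 ?rnorm_ge0// ler_wpM2r ?rnorm_ge0.
Qed.

Lemma rnorm_resolvent_opp {b} :
  rnorm b <= 1 / 11 -> rnorm (resolvent (- b)) <= 11 / 10.
Proof.
rewrite -rnormN => nb; apply: (le_trans (rnorm_resolvent nb _)); first by lra.
by rewrite -div1r ler_pdivrMr; lra.
Qed.

Lemma rnorm_1D_le {b} : rnorm b <= 1 / 11 -> rnorm (1 + b) <= 12 / 11.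
Proof. by have := rnormD 1 b; rewrite rnorm1; lra. Qed.

End Estimates.

Lemma sqr_bound_le11 {R : realFieldType} (N x : R) :
  0 <= N -> 1 <= x -> N * (11 * x ^+ 2) < 1 -> N <= 1 / 11.
Proof.
move=> N0 x1 nx; have : N * 1 <= N * x ^+ 2 by rewrite ler_wpM2l// exprn_ege1.
have -> : N * x ^+ 2 = N * (11 * x ^+ 2) / 11 by field.
by lra.
Qed.

(* AM-GM: [2 N x y <= N x^2 + N y^2]. *)
Lemma alternating_word_bound {R : realFieldType} (N x y : R) :
  0 <= N -> 1 <= x -> 1 <= y ->
  N * (11 * x ^+ 2) < 1 -> N * (11 * y ^+ 2) < 1 ->
  (22 / 16 * x + 1) * N * (11 / 10) * (22 / 16 * y + 1) < 1.
Proof.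
move=> N0 x1 y1 nx ny.
have xy : N * (x * y) <= 1 / 11.
  have := mulr_ge0 N0 (sqr_ge0 (x - y)).
  have -> : N * (x - y) ^+ 2 =
    (N * (11 * x ^+ 2) + N * (11 * y ^+ 2)) / 11 - 2 * (N * (x * y)) by field.
  by lra.
(* As [x, y >= 1], each summand [1] is absorbed: [22/16 + 1 = 38/16]. The final constant is
   [11/10 * 361/64 * 1/11 = 361/640]. *)
have k3 : (22 / 16 * x + 1) * (22 / 16 * y + 1) <= 38 / 16 * x * (38 / 16 * y).
  by apply: ler_pM; lra.
have := ler_wpM2l N0 k3.
have -> : N * (38 / 16 * x * (38 / 16 * y)) = 361 / 64 * (N * (x * y)) by field.
have -> : (22 / 16 * x + 1) * N * (11 / 10) * (22 / 16 * y + 1) =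
  11 / 10 * (N * ((22 / 16 * x + 1) * (22 / 16 * y + 1))) by ring.
by lra.
Qed.

Lemma min_complexr {R : realType} (x y : R) :
  Num.min x%:C%C y%:C%C = (Num.min x y)%:C%C.
Proof. by rewrite /Order.min ltcR; case: ifP. Qed.

(** * Multiplicativity of the S-transform *)

Theorem theorem4p5 (R : realType) (A : banachAlg R[i]) (B : set A)
    (hB : comm_banach_subalgebra B)
    (E : {linear A -> A}) (hE : cond_expectation B E)
    (a1 a2 : A) (ha1 : a1 != 0) (ha2 : a2 != 0)
    (hfree : free_over B E a1 a2)
    (hE1 : invertible_in B (E a1)) (hE2 : invertible_in B (E a2))
    (b : A) (hb : invertible_in B b)
    (hnorm : `|b| < Num.min (S_radius B E a1)
                      (Num.min (S_radius B E a2) (S_radius B E (a1 * a2)))) :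
  S_transform B E (a1 * a2) b = S_transform B E a1 b * S_transform B E a2 b.
Proof.
have subB := cbs_subalgebra hB; have mulC := cbs_comm hB.
have BM := subalgM subB.
have Bb : B b := hb.1.
have [Bbi bbi bib] := inv_inP hb.
have [Bm1 em1 me1] := inv_inP hE1; have [Bm2 em2 me2] := inv_inP hE2.
have t1 := rnorm_mul_inv_cexp_ge1 hE hE1.
have t2 := rnorm_mul_inv_cexp_ge1 hE hE2.
have E12 := cexp_free_mul hB hE hfree.
have BE1 := cexp_mem hE a1; have BE2 := cexp_mem hE a2.
set bi := inv_in B b in Bbi bbi bib *.
set m1 := inv_in B (E a1) in Bm1 em1 me1 t1 *.
set m2 := inv_in B (E a2) in Bm2 em2 me2 t2 *.
have i12 : is_inverse_in B (E (a1 * a2)) (m1 * m2).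
  have e : E a1 * E a2 * (m1 * m2) = 1.
    by rewrite (mulC m1)// -mulrA (mulrA (E a2)) em2 mul1r.
  split; [exact: BM|by rewrite E12|].
  by rewrite E12 mulC//; exact: BM.
have m12 := inv_in_unique i12.
have hE12 : invertible_in B (E (a1 * a2)).
  by split; [exact: (cexp_mem hE)|exists (m1 * m2)].
have ha12 : a1 * a2 != 0.
  apply/eqP => a120; have [_ + _] := i12.
  by rewrite a120 raddf0 mul0r => /esym/eqP; rewrite oner_eq0.
move: hnorm; rewrite !S_radiusE !min_complexr normE ltcR !lt_min m12 -/m1 -/m2.
have t12 := rnorm_mul_inv_cexp_ge1 hE hE12.
rewrite m12 in t12.
set al1 := rnorm a1 in t1 *; set al2 := rnorm a2 in t2 *.
set mu1 := rnorm m1 in t1 *; set mu2 := rnorm m2 in t2 *.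
set al := rnorm (a1 * a2) in t12 *; set mu := rnorm (m1 * m2) in t12 *.
have N0 := rnorm_ge0 b; set N := rnorm b in N0 *.
have radius (x y : R) : 1 <= x * y -> 0 <= x -> 0 <= y ->
    N < (11 * x ^+ 2 * y ^+ 2)^-1 -> N * (11 * x ^+ 2 * y ^+ 2) < 1.
  move=> xy x0 y0; rewrite -div1r ltr_pdivlMr// -mulrA mulr_gt0// -exprMn.
  by rewrite exprn_gt0//; lra.
move=> /and3P[/radius n1 /radius n2 /radius n12].
have {}n1 := n1 t1 (rnorm_ge0 _) (rnorm_ge0 _).
have {}n2 := n2 t2 (rnorm_ge0 _) (rnorm_ge0 _).
have {}n12 := n12 t12 (rnorm_ge0 _) (rnorm_ge0 _).
have [c1 [v1 [[Bc1 c1E nc1] [Bv1 nv1] _ Psi1 e1]]] :=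
  Psi_inv_solution hB hE ha1 hE1 _ Bb n1.
have [c2 [v2 [[Bc2 c2E nc2] [Bv2 nv2] [v2' Bv2' vv2] Psi2 e2]]] :=
  Psi_inv_solution hB hE ha2 hE2 _ Bb n2.
rewrite -/m1 in c1E; rewrite -/m2 in c2E.
have B1b : B (1 + b) by apply: (subalgD subB) => //; exact: subalg1.
have Bbm2 : B (b * m2) by exact: BM.
set k := bi * (1 + b).
have Bk : B k by exact: BM.
have c2bi : c2 * bi = m2 * v2.
  have Bmv : B (m2 * v2) by exact: BM.
  by rewrite c2E -(mulrA b) (mulC _ _ Bb Bmv) -[_ * b * bi]mulrA bbi mulr1.
(* The [bi] in [k] cancels one of the two factors [b], and [m1 * m2] is the inverse of
   [E (a1 * a2)]; the norm is thus controlled by [N * mu]. *)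
have cE : k * c1 * c2 = (1 + b) * b * (m1 * m2) * v1 * v2.
  have -> : k * c1 = (1 + b) * (m1 * v1).
    by rewrite /k (mulC bi)// c1E -!mulrA (mulrA bi) bib mul1r.
  rewrite c2E -!mulrA; congr (_ * _).
  rewrite (mulrA v1) (mulC v1 b)// !mulrA (mulC m1 b)// -!mulrA.
  by rewrite (mulrA v1) (mulC v1 m2)// !mulrA.
have inv2 : is_inverse_in B c2 (v2' * E a2 * bi).
  have e : c2 * (v2' * E a2 * bi) = 1.
    rewrite c2E -!mulrA (mulrA v2) vv2 mul1r (mulrA m2) me2 mul1r.
    exact: bbi.
  have Bi : B (v2' * E a2 * bi) by do 2 (apply: (BM) => //).
  by split => //; rewrite mulC.
have lt322 : (3 / 22 : R) < 1 by rewrite ltr_pdivrMr// mul1r ltr_nat.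
have N11 : N <= 1 / 11.
  by apply: (sqr_bound_le11 _ _ N0 t1); move: n1; rewrite -mulrA exprMn.
(* The constant [12/11 * (19/16)^2 * 4/11] is below [1], so [k * c1 * c2] lies in the injectivity
   ball for [a1 * a2]. *)
have nca : rnorm (k * c1 * c2) * (4 * al ^+ 2 * mu) < 1.
  have h1 : rnorm (k * c1 * c2) <= 12 / 11 * N * mu * (19 / 16) * (19 / 16).
    rewrite cE.
    do 2 (apply: (le_trans (rnormM _ _)); apply: ler_pM; rewrite ?rnorm_ge0//).
    apply: (le_trans (rnorm_mul3 _ _ _)); rewrite ler_wpM2r ?rnorm_ge0//.
    by rewrite ler_wpM2r// rnorm_1D_le.
  have al0 : 0 <= 4 * al ^+ 2 * mu by rewrite !mulr_ge0 ?rnorm_ge0 ?exprn_ge0 ?rnorm_ge0.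
  apply: (le_lt_trans (ler_wpM2r al0 h1)).
  have -> : 12 / 11 * N * mu * (19 / 16) * (19 / 16) * (4 * al ^+ 2 * mu) =
    (12 / 11 * (19 / 16) * (19 / 16) * 4 / 11) * (N * (11 * al ^+ 2 * mu ^+ 2)) by field.
  by clear - n12; lra.
have e12 : E (resolvent (k * c1 * c2 * (a1 * a2))) = 1 + b.
  apply: (cexp_resolvent_free_product hB hE hfree _ _ _ _ _ Bb _ _ Bc1 Bc2 inv2) => //.
  - by apply: (le_lt_trans N11); rewrite ltr_pdivrMr// mul1r ltr1n.
  - by exact: le_lt_trans (le_trans (rnormM _ _) nc1) lt322.
  - by exact: le_lt_trans (le_trans (rnormM _ _) nc2) lt322.
  - by rewrite (le_lt_trans (rnormM _ _))// mulrC (le_lt_trans nc2).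
  (* The first factor is linear in [N] and the second free of it, which is the shape of
     [alternating_word_bound]. *)
  - have hx := rnorm_resolvent_center c1E nv1 nc1.
    have nc2' : rnorm a2 * rnorm c2 <= 3 / 22 by rewrite mulrC.
    have hp := rnorm_resolvent_center_div bbi c2bi nv2 nc2'.
    have hu := rnorm_resolvent_opp N11.
    apply: (le_lt_trans (rnormM _ _)).
    have hxu := le_trans (rnormM _ _) (ler_pM (rnorm_ge0 _) (rnorm_ge0 _) hx hu).
    apply: (le_lt_trans (ler_pM (rnorm_ge0 _) (rnorm_ge0 _) hxu hp)).
    rewrite -/al1 -/al2 -/mu1 -/mu2 -/N.
    apply: alternating_word_bound => //.
      by move: n1; rewrite -mulrA exprMn.
    by move: n2; rewrite -mulrA exprMn.
  - by apply: (rnorm_mul_lt1 hE ha12 hE12); rewrite m12 ltW.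
(* It remains to compare [k * (k * c1 * c2)] with [k * c1 * (k * c2)]; [k] and [c1] commute in
   [B]. *)
rewrite /S_transform Psi1 Psi2 -/bi -/k.
rewrite (Psi_inv_unique hB hE ha12 hE12 _ (k * c1 * c2)) //; last by rewrite m12.
  by clearbody k; rewrite -!mulrA; congr (_ * _); rewrite !mulrA (mulC k c1).
by apply: (BM) => //; exact: BM.
Qed.
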